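(* Let $k\ge 1$ and $a_1,\ldots,a_k$ be positive integers, and let $G$ be a simple graph that is degree equivalent to the complete $k$-partite graph $K_{a_1,\ldots,a_k}$. Then $\omega(G)=k$ if and only if $G$ is isomorphic to $K_{a_1,\ldots,a_k}$.
   Context: All graphs are finite simple graphs (no loops, no multiple edges). The degree sequence $D(G)$ of a graph $G$ is the multiset of degrees of its vertices; two graphs are degree equivalent if they have the same degree sequence. $\omega(G)$ is the clique number (size of a largest clique). $K_{a_1,\ldots,a_k}$ denotes the complete $k$-partite graph whose vertex set is partitioned into $k$ independent sets of sizes $a_1,\ldots,a_k$, with any two vertices in different parts adjacent. *)

(* Defs.v *)
From mathcomp Require Import all_boot.
From mathcomp Require Import finmap multiset.

Set Implicit Arguments.
Unset Strict Implicit.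
Unset Printing Implicit Defensive.

Record sgraph := SGraph {
  vertex :> finType;
  adj : rel vertex;
  adj_sym : symmetric adj;
  adj_irrefl : irreflexive adj
}.

Definition degree (G : sgraph) (x : G) : nat := #|[set y : G | adj x y]|.

Definition degree_sequence (G : sgraph) : {mset nat}%mset :=
  seq_mset [seq degree x | x : G].

Definition degree_equivalent (G H : sgraph) : Prop :=
  degree_sequence G = degree_sequence H.

Definition clique (G : sgraph) (A : {set G}) : bool :=
  [forall x in A, forall y in A, (x != y) ==> adj x y].

Definition clique_number (G : sgraph) : nat :=
  \max_(A : {set G} | clique A) #|A|.

Definition isomorphic (G H : sgraph) : Prop :=
  exists2 f : G -> H, bijective f & forall x y : G, adj (f x) (f y) = adj x y.

Section CompleteMultipartite.

Variables (k : nat) (a : 'I_k -> nat).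

(* The vertex set is the disjoint union of the parts; [tag x] is the index of
   the part containing x. *)
Let V : finType := {i : 'I_k & 'I_(a i)}.

Definition multipartite_adj : rel V := fun x y => tag x != tag y.

Lemma multipartite_adj_sym : symmetric multipartite_adj.
Proof. by move=> x y; rewrite /multipartite_adj eq_sym. Qed.

Lemma multipartite_adj_irrefl : irreflexive multipartite_adj.
Proof. by move=> x; rewrite /multipartite_adj eqxx. Qed.

Definition complete_multipartite : sgraph :=
  SGraph multipartite_adj_sym multipartite_adj_irrefl.

End CompleteMultipartite.

(* Main.v *)
(* For a vertex [x] of a graph on [n] vertices put [w x = 1 / (n - degree x)].
   The Caro-Wei bound for the complement says that some clique has at least
   [\sum_x w x] vertices; the greedy proof shows that equality forces
   non-adjacency to be transitive, i.e. the graph to be complete multipartite.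
   The sum depends only on the degree sequence, and it is [k] for a complete
   [k]-partite graph, since a part of size [m] consists of [m] vertices of
   weight [1 / m].  Finally a complete multipartite graph is determined by its
   degree sequence: the number of parts of size [m] is [1 / m] times the number
   of vertices of degree [n - m]. *)

Require Import Defs.
From mathcomp Require Import all_boot.
From mathcomp Require Import all_order all_algebra finmap multiset.

Set Implicit Arguments.
Unset Strict Implicit.
Unset Printing Implicit Defensive.

Import Order.TTheory GRing.Theory Num.Theory.

Lemma leif_invn (m n : nat) : 0 < m <= n ->
  ((n%:R^-1 : rat) <= m%:R^-1 ?= iff (n == m))%R.
Proof.
case/andP=> m0 lemn; have n0 := leq_trans m0 lemn.
split; first by rewrite lef_pV2 ?posrE ?ltr0n // ler_nat.
by rewrite (inj_eq invr_inj) eqr_nat.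
Qed.

(** * The greedy Caro-Wei bound and its equality case *)

Section Greedy.

Variables (T : finType) (e : rel T).
Hypotheses (e_refl : reflexive e) (e_sym : symmetric e).

(** Since [e] is reflexive, this is a closed neighbourhood: for [x] in [S] its size is one plus the
    usual degree. *)
Definition nbh (S : {set T}) x := [set y in S | e x y].

Definition independent (A : {set T}) :=
  [forall x in A, forall y in A, (x != y) ==> ~~ e x y].

Definition cw_weight (S : {set T}) : rat :=
  (\sum_(x in S) (#|nbh S x|%:R)^-1)%R.

Lemma nbh_gt0 (S : {set T}) x : x \in S -> 0 < #|nbh S x|.
Proof. by move=> xS; apply/card_gt0P; exists x; rewrite inE xS e_refl. Qed.

Lemma nbhS (S S' : {set T}) x : S' \subset S -> nbh S' x \subset nbh S x.
Proof. by move/subsetP=> sS; apply/subsetP=> y; rewrite !inE => /andP[/sS-> ->]. Qed.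

Lemma independentU1 (S : {set T}) v (A : {set T}) :
  A \subset S :\: nbh S v -> independent A -> independent (v |: A).
Proof.
move=> /subsetP sA indA.
have vA y : y \in A -> ~~ e v y.
  by move/sA; rewrite !inE; case: (y \in S); rewrite ?andbF // andbT.
apply/forall_inP=> x /setU1P xvA; apply/forall_inP=> y /setU1P yvA.
apply/implyP; case: xvA yvA => [->|xA] [->|yA]; rewrite ?eqxx // => neq.
- exact: vA.
- by rewrite e_sym vA.
by move/forall_inP/(_ x xA)/forall_inP/(_ y yA)/implyP: indA; apply.
Qed.

(* Greedy step at a point [v] of minimal degree: the neighbourhood [nbh S v]
   contributes at most 1 to the weight, and deleting it does not decrease the
   weight of the remaining points. *)
Lemma cw_weight_step (S : {set T}) v : v \in S ->
    (forall x, x \in S -> #|nbh S v| <= #|nbh S x|) ->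
  (cw_weight S <= 1 + cw_weight (S :\: nbh S v)
     ?= iff [forall x in nbh S v, #|nbh S x| == #|nbh S v|] &&
            [forall x in S :\: nbh S v,
                #|nbh S x| == #|nbh (S :\: nbh S v) x|])%R.
Proof.
move=> vS vmin; set N := nbh S v; set S' := S :\: N.
have NS : N \subset S by apply/subsetP=> x; rewrite inE => /andP[].
(* Splitting 1 into equal shares over [N] lets both sides be compared term by term, equality cases
   included. *)
have -> : (1 = \sum_(x in N) (#|N|%:R)^-1 :> rat)%R.
  rewrite sumr_const -[RHS]mulr_natl mulfV // pnatr_eq0 -lt0n; exact: nbh_gt0.
rewrite /cw_weight (big_setID N) /= (setIidPr NS).
apply: leifD; apply: leif_sum => x.
  move=> xN; apply: leif_invn; rewrite nbh_gt0 //= vmin //; exact: (subsetP NS).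
move=> xS'; apply: leif_invn; rewrite nbh_gt0 //=.
by apply/subset_leq_card/nbhS/subsetDl.
Qed.

(** Induction on the size of [S]: a point of minimal degree joins the independent set found outside
    its closed neighbourhood. Equality for [S] forces equality in the greedy step and in the
    induction hypothesis. *)
Lemma caro_wei (S : {set T}) : exists A : {set T},
  [/\ A \subset S, independent A, (cw_weight S <= #|A|%:R)%R &
      cw_weight S = (#|A|%:R)%R -> {in S & &, transitive e}].
Proof.
have [n] := ubnP #|S|; elim: n => // n IHn in S *; rewrite ltnS => leSn.
have [->|[v0 v0S]] := set_0Vmem S.
  exists set0; rewrite sub0set cards0 /cw_weight big_set0; split=> //; last first.
    by move=> _ y x z; rewrite inE.
  by apply/forall_inP=> x; rewrite inE.
case: (@arg_minnP _ v0 [in S] (fun x => #|nbh S x|) v0S) => v vS vmin.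
have := cw_weight_step vS vmin; set N := nbh S v; set S' := S :\: N.
have vN : v \in N by rewrite inE vS e_refl.
have NS : N \subset S by apply/subsetP=> x; rewrite inE => /andP[].
have S'S : S' \subset S by apply: subsetDl.
have [|A [sA indA leA trA]] := IHn S'.
  apply: leq_trans leSn; apply: proper_card; apply/properP; split=> //.
  by exists v; rewrite // inE vN.
move=> [leS eqS]; exists (v |: A).
have vA : v \notin A by apply/negP => /(subsetP sA); rewrite inE vN.
have le1A : (1 + cw_weight S' <= #|v |: A|%:R)%R.
  by rewrite cardsU1 vA natrD lerD2l.
split; first 1 last.
- exact: independentU1 sA indA.
- exact: le_trans le1A.
- move=> eqSA; have eqW : cw_weight S = (1 + cw_weight S')%R.
    by apply/eqP; rewrite eq_le leS eqSA.
  move: eqS; rewrite {1}eqW eqxx => /esym/andP[/forall_inP eqN /forall_inP eqS'].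
  have {}trA : {in S' & &, transitive e}.
    apply: trA; apply: (@addrI _ 1%R).
    by rewrite -eqW eqSA cardsU1 vA natrD.
  have nbhS' x : x \in S' -> nbh S x = nbh S' x.
    move=> xS'; apply/esym/eqP.
    by rewrite eqEcard nbhS //= (eqP (eqS' _ xS')).
  (* A neighbour [y] of [x] outside [N] would lie in [S'], where deleting [N] costs [y] no
     neighbour; yet it would cost [x]. *)
  have nbhN x : x \in N -> nbh S x = N.
    move=> xN; apply/eqP; rewrite eqEcard (eqP (eqN _ xN)) leqnn andbT.
    apply/subsetP=> y yx; have [yS exy] : y \in S /\ e x y.
      by apply/andP; rewrite inE in yx.
    apply: contraT => yN; have yS' : y \in S' by rewrite inE yN.
    have : x \in nbh S' y by rewrite -nbhS' // inE e_sym exy (subsetP NS).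
    by rewrite !inE; move: xN; rewrite inE => ->.
  (* No pair of [e] joins [N] to [S'], so a chain stays in one of them: [N] is complete for [e], and
     [S'] is covered by induction. *)
  move=> y x z yS xS zS exy eyz; have [xN|xN] := boolP (x \in N).
    have yN : y \in N by rewrite -(nbhN x xN) inE yS.
    have : z \in N by rewrite -(nbhN y yN) inE zS.
    by rewrite -(nbhN x xN) inE => /andP[].
  have xS' : x \in S' by rewrite inE xN.
  have yS' : y \in S'.
    have : y \in nbh S' x by rewrite -nbhS' // inE yS.
    by rewrite inE => /andP[].
  have zS' : z \in S'.
    have : z \in nbh S' y by rewrite -nbhS' // inE zS.
    by rewrite inE => /andP[].
  exact: trA exy eyz.
by rewrite subUset sub1set vS (subset_trans sA).
Qed.

End Greedy.

(** * Matching the fibres of maps between finite types *)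

Lemma fiber_inj (X Y : finType) (C : eqType) (f : X -> C) (g : Y -> C) :
    (forall c, #|[pred x | f x == c]| <= #|[pred y | g y == c]|) ->
  exists2 h : X -> Y, injective h & forall x, g (h x) = f x.
Proof.
move=> lefg; pose F c := enum [pred x | f x == c].
pose G c := enum [pred y | g y == c].
have xF x : x \in F (f x) by rewrite mem_enum inE.
have ltG x : index x (F (f x)) < size (G (f x)).
  have : index x (F (f x)) < size (F (f x)) by rewrite index_mem.
  by move/leq_trans; apply; rewrite -!cardE; apply: lefg.
(* The image of [x] has the same rank in its fibre as [x] has. It serves as its own default for
   [nth], since no point of [Y] is given beforehand. *)
have has_nth x : {y | y = nth y (G (f x)) (index x (F (f x))) & g y = f x}.
  move: (ltG x); case EG: (G (f x)) => [|y0 s] // lt_s.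
  exists (nth y0 (y0 :: s) (index x (F (f x)))); first exact: set_nth_default.
  by apply/eqP; move: (mem_nth y0 lt_s); rewrite -EG mem_enum.
pose h x := s2val (has_nth x).
have hE x : h x = nth (h x) (G (f x)) (index x (F (f x))).
  by rewrite /h; case: (has_nth x).
have gh x : g (h x) = f x by rewrite /h; case: (has_nth x).
exists h => // x x' eqh.
have eqf : f x = f x' by rewrite -!gh eqh.
have := hE x; rewrite {1}eqh hE -eqh -eqf => /eqP.
rewrite nth_uniq ?enum_uniq ?ltG //; last by rewrite eqf ltG.
by move/eqP=> eqi; rewrite -(nth_index x (xF x)) -eqi eqf nth_index.
Qed.

Lemma fiber_bij (X Y : finType) (C : eqType) (f : X -> C) (g : Y -> C) :
    (forall c, #|[pred x | f x == c]| = #|[pred y | g y == c]|) ->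
  exists2 h : X -> Y, bijective h & forall x, g (h x) = f x.
Proof.
move=> eqfg; have [c|h injh gh] := @fiber_inj X Y C f g; first by rewrite eqfg.
have [c|h' injh' _] := @fiber_inj Y X C g f; first by rewrite eqfg.
by exists h => //; apply: inj_card_bij => //; apply: leq_card injh'.
Qed.

(** For [m > 0] this recovers the number of fibres of size [m] from the number of points lying in
    them. *)
Lemma card_preim_fiber (X Z : finType) (t : X -> Z) (w : Z -> nat) m :
    (forall z, #|[pred x | t x == z]| = w z) ->
  #|[pred x | w (t x) == m]| = #|[pred z | w z == m]| * m.
Proof.
move=> wE; rewrite -sum1_card (partition_big t [pred z | w z == m]) //=.
rewrite -sum_nat_const; apply: eq_bigr => z /eqP wz.
rewrite -[RHS]wz -wE -sum1_card; apply: eq_bigl => x; rewrite !inE.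
by case: (t x =P z) => [->|]; rewrite ?andbF // wz eqxx.
Qed.

(* Two surjections onto finite index sets are isomorphic as soon as the fibre
   sizes, counted once for every point of the source, agree. *)
Lemma fibration_iso (X Y Z I : finType) (t : X -> Z) (s : Y -> I)
    (w : Z -> nat) (a : I -> nat) :
    (forall z, #|[pred x | t x == z]| = w z) ->
    (forall i, #|[pred y | s y == i]| = a i) ->
    (forall z, 0 < w z) -> (forall i, 0 < a i) ->
    (forall m, #|[pred x | w (t x) == m]| = #|[pred y | a (s y) == m]|) ->
  exists2 h : X -> Y, bijective h &
    forall x x', (s (h x) == s (h x')) = (t x == t x').
Proof.
move=> wE aE w0 a0 eqwa.
have [m|sigma bij_sigma aw] := @fiber_bij Z I nat w a.
  (* At [m = 0] nothing can be cancelled, but positivity makes both counts vanish. *)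
  have [->|m0] := posnP m.
    by rewrite !eq_card0 // => z; rewrite inE eqn0Ngt ?w0 ?a0.
  apply/eqP; rewrite -(eqn_pmul2r m0).
  by rewrite -(card_preim_fiber m wE) -(card_preim_fiber m aE) eqwa.
have inj_sigma := bij_inj bij_sigma.
have [i|h bijh sh] := @fiber_bij X Y I (sigma \o t) s.
  have [tau _ tauK] := bij_sigma; rewrite aE -[i]tauK aw -wE.
  by apply: eq_card => x; rewrite !inE /= (inj_eq inj_sigma).
by exists h => // x x'; rewrite !sh /= (inj_eq inj_sigma).
Qed.

(** * Consequences of degree equivalence with a complete multipartite graph *)

Section DegreeSequence.

Variables (k : nat) (a : 'I_k -> nat) (G : sgraph).
Hypothesis ha : forall i : 'I_k, 0 < a i.
Let K := complete_multipartite a.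
Hypothesis hG : degree_equivalent G K.

Definition nonadj (H : sgraph) : rel H := fun x y => ~~ adj x y.

Lemma nonadj_refl H : reflexive (@nonadj H).
Proof. by move=> x; rewrite /nonadj adj_irrefl. Qed.

Lemma nonadj_sym H : symmetric (@nonadj H).
Proof. by move=> x y; rewrite /nonadj adj_sym. Qed.

Lemma card_nonadj (H : sgraph) (x : H) :
  #|nbh (@nonadj H) setT x| = #|H| - degree x.
Proof.
rewrite -(cardsC [set y | adj x y]) addKn.
by apply: eq_card => y; rewrite !inE.
Qed.

Lemma independent_nonadj (H : sgraph) (A : {set H}) :
  independent (@nonadj H) A = clique A.
Proof.
apply: eq_forallb => x; congr (_ ==> _).
by apply: eq_forallb => y; rewrite /nonadj negbK.
Qed.

Lemma perm_degree : perm_eq [seq degree x | x : G] [seq degree x | x : K].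
Proof. exact/eq_seq_msetP. Qed.

Lemma card_degree_equivalent : #|G| = #|K|.
Proof. by have := perm_size perm_degree; rewrite !size_image. Qed.

Lemma card_fiber_tag i : #|[pred y : K | tag y == i]| = a i.
Proof.
rewrite -[RHS]card_ord (bij_eq_card (tag_with_bij (fun i => 'I_(a i)) i)).
by rewrite card_sub; apply: eq_card => y; rewrite !inE.
Qed.

Lemma card_nonadj_multipartite (y : K) :
  #|nbh (@nonadj K) setT y| = a (tag y).
Proof.
rewrite -card_fiber_tag; apply: eq_card => z.
by rewrite !inE /nonadj /= /multipartite_adj negbK eq_sym.
Qed.

Lemma cw_weight_degree (H : sgraph) :
  cw_weight (@nonadj H) setT
    = (\sum_(d <- [seq degree x | x : H]) (#|H| - d)%:R^-1)%R.
Proof.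
rewrite big_image /cw_weight.
by apply: eq_big => x; rewrite ?inE // card_nonadj.
Qed.

Lemma cw_weight_multipartite : cw_weight (@nonadj K) setT = (k%:R)%R.
Proof.
rewrite /cw_weight (partition_big (fun y : K => tag y) predT) //=.
rewrite -[k in RHS]card_ord -sumr_const; apply: eq_bigr => i _.
rewrite (eq_bigr (fun=> (a i)%:R^-1)%R); last first.
  by move=> y /andP[_ /eqP <-]; rewrite card_nonadj_multipartite.
rewrite (eq_bigl [in [pred y : K | tag y == i]]); last by move=> y; rewrite !inE.
by rewrite sumr_const -[LHS]mulr_natl card_fiber_tag mulfV // pnatr_eq0 -lt0n.
Qed.

Lemma cw_weight_equivalent : cw_weight (@nonadj G) setT = (k%:R)%R.
Proof.
rewrite -cw_weight_multipartite !cw_weight_degree card_degree_equivalent.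
exact: perm_big perm_degree.
Qed.

Lemma clique_leq (H : sgraph) (A : {set H}) :
  clique A -> #|A| <= clique_number H.
Proof. exact: leq_bigmax_cond. Qed.

Lemma card_degree_class m :
  #|[pred x : G | #|G| - degree x == m]|
    = #|[pred y : K | #|K| - degree y == m]|.
Proof.
have countE (H : sgraph) : #|[pred x : H | #|H| - degree x == m]|
    = count (fun d => #|H| - d == m) [seq degree x | x : H].
  rewrite count_map -size_filter cardE.
  by congr size; rewrite enumT /enum_mem -enumT.
by rewrite !countE card_degree_equivalent; apply/permP/perm_degree.
Qed.

(** Non-adjacency is then an equivalence whose classes act as parts; the class of [x] has
    [#|G| - degree x] points, so the degrees determine the class sizes. *)
Lemma transitive_nonadj_isomorphic : transitive (@nonadj G) -> isomorphic G K.
Proof.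
move=> tr.
pose c (x : G) := nbh (@nonadj G) setT x.
have cE x y : (c x == c y) = nonadj x y.
  apply/eqP/idP => [eqc|xy].
    have : y \in c y by rewrite !inE nonadj_refl.
    by rewrite -eqc !inE.
  apply/setP=> z; rewrite !inE /=; apply/idP/idP; last exact: tr.
  by apply: tr; rewrite nonadj_sym.
pose P := [set c x | x : G]; pose Z : finType := {B | B \in P}.
have cP x : c x \in P by apply: imset_f.
pose t x : Z := exist _ (c x) (cP x).
have [|||||h bijh hE] := @fibration_iso G K Z 'I_k t (fun y : K => tag y)
  (fun B => #|val B|) a.
- case=> B BP /=; have [x _ Bx] := imsetP BP.
  rewrite [in RHS]Bx; apply: eq_card => y; rewrite !inE -val_eqE /= Bx cE.
  exact: nonadj_sym.
- exact: card_fiber_tag.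
- case=> B /= /imsetP[x _ ->]; exact: (nbh_gt0 (@nonadj_refl G)) (in_setT x).
- exact: ha.
- move=> m; transitivity #|[pred x : G | #|G| - degree x == m]|.
    by apply: eq_card => x; rewrite !inE /= card_nonadj.
  rewrite card_degree_class; apply: eq_card => y.
  by rewrite !inE -card_nonadj card_nonadj_multipartite.
exists h => // x y.
by rewrite /= /multipartite_adj hE -val_eqE /= cE negbK.
Qed.

(** A clique meets each part at most once, and choosing the first vertex of every part gives a
    clique of size [k]. *)
Lemma isomorphic_clique_number : isomorphic G K -> clique_number G = k.
Proof.
case=> f [g fK gK] fadj; apply/eqP; rewrite eqn_leq; apply/andP; split.
  apply/bigmax_leqP => A /forall_inP cliA.
  rewrite -(card_in_imset (f := fun x => tag (f x))) => [|x y xA yA eqt].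
    by rewrite -[leqRHS]card_ord max_card.
  apply/eqP; apply: contraT => neq.
  have /forall_inP/(_ y yA)/implyP/(_ neq) := cliA x xA.
  by rewrite -fadj /= /multipartite_adj eqt eqxx.
pose r i : G := g (Tagged (fun i => 'I_(a i)) (Ordinal (ha i))).
have rt i : tag (f (r i)) = i by rewrite /r gK.
have injr : injective r by move=> i j eqr; rewrite -(rt i) eqr rt.
rewrite -[leqLHS]card_ord -(card_imset predT injr); apply: clique_leq.
apply/forall_inP=> _ /imsetP[i _ ->]; apply/forall_inP=> _ /imsetP[j _ ->].
by apply/implyP; rewrite (inj_eq injr) -fadj /= /multipartite_adj !rt.
Qed.

End DegreeSequence.

Theorem theorem1 (k : nat) (a : 'I_k -> nat) (G : sgraph)
  (hk : 1 <= k) (ha : forall i : 'I_k, 0 < a i)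
  (hG : degree_equivalent G (complete_multipartite a)) :
  clique_number G = k <-> isomorphic G (complete_multipartite a).
Proof.
split=> [omk|]; last exact: isomorphic_clique_number.
have [A [_ indA]] := caro_wei (@nonadj_refl G) (@nonadj_sym G) setT.
rewrite (cw_weight_equivalent ha hG) ler_nat => leA trA.
rewrite independent_nonadj in indA.
(* The clique number bounds [A] from above and the weight bounds it from below, so the equality case
   applies. *)
have Ak : #|A| = k by apply/eqP; rewrite eqn_leq leA andbT -omk clique_leq.
apply: transitive_nonadj_isomorphic => // y x z.
by apply: trA; rewrite ?Ak ?inE.
Qed.
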